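(* Let $\lambda$ be an infinite ordinal, let $A\subset\omega^\omega$, and suppose $A=\mathrm{p}(B)$ for a set $B\subset\omega^\omega\times\lambda^\omega$. Then: (i) If Player I has a winning strategy in the game $\tilde G_p(B)$, then $A$ contains a nonempty superperfect subset $P$. (ii) If Player II has a winning strategy in the game $\tilde G_p(B)$, then $A$ is $\lambda$-bounded.
   Context: $\omega^\omega$ is the Baire space and $\mathrm{p}(B)=\{f\in\omega^\omega : \exists \xi\in\lambda^\omega\ (f,\xi)\in B\}$. For $f,g\in\omega^\omega$, $f\leq g$ means $f(n)\leq g(n)$ for all $n$. A set $A\subset\omega^\omega$ is $\lambda$-bounded if there is a family $\{f_i\in\omega^\omega : i<\lambda\}$ such that for every $f\in A$ there is $i<\lambda$ with $f\leq f_i$. A tree on $\omega$ is a set $T$ of finite sequences of natural numbers closed under initial segments; $[T]$ is the set of $f\in\omega^\omega$ all of whose finite initial segments lie in $T$. A tree $T$ is superperfect if every $u\in T$ has an extension $v\in T$ (possibly $v=u$) such that $\{m<\omega : v\cdot(m)\in T\}$ is infinite, where the dot denotes concatenation of sequences. A set $P\subset\omega^\omega$ is superperfect if $P=[T]$ for some superperfect tree $T$. The game $\tilde G_p(B)$: Players I and II alternate with perfect information; I plays $(\xi_0,u_0)$, II plays $n_1$, I plays $(\xi_1,u_1)$, II plays $n_2$, I plays $(\xi_2,u_2)$, and so on, where $\xi_i\in\lambda$, each $u_i$ is a nonempty finite sequence of natural numbers, and $n_i\in\omega$. Let $\xi=(\xi_0,\xi_1,\ldots)\in\lambda^\omega$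 and $f=u_0\cdot u_1\cdot u_2\cdots\in\omega^\omega$. Player I wins if $(f,\xi)\in B$ and $u_i(0)>n_i$ for all $i\geq 1$, where $u_i(0)$ is the first entry of $u_i$. Otherwise Player II wins. Strategies and winning strategies are understood in the usual sense. *)

(* Defs.v *)
From mathcomp Require Export all_boot all_order.
From mathcomp Require Export boolp classical_sets cardinality.
From mathcomp Require wochoice.

Set Implicit Arguments.
Unset Strict Implicit.
Unset Printing Implicit Defensive.

Local Open Scope classical_set_scope.

Notation baire := (nat -> nat).

Section Defs.
Variable L : Type.

Definition proj (B : set (baire * (nat -> L))) : set baire :=
  [set f | exists xi : nat -> L, B (f, xi)].

Definition family_bounded (A : set baire) : Prop :=
  exists F : L -> baire,
    forall f, A f -> exists i : L, forall n, f n <= F i n.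

Definition block := {u : seq nat | u != [::]}.

(* Since every block is nonempty, u_0 ... u_k has length > k, so its k-th entry
   is the k-th entry of the infinite concatenation (see [concatE]). *)
Definition concat (u : nat -> block) : baire :=
  fun k => nth 0 (flatten (mkseq (fun i => val (u i)) k.+1)) k.

(* A run is given by the moves x i = (xi_i, u_i) of Player I and the answers
   n i of Player II for i >= 1; the value n 0 is a dummy. Strategies read the
   opponent's previous moves. *)
Definition moveI := (L * block)%type.

Definition strategyI := seq nat -> moveI.
Definition strategyII := seq moveI -> nat.

Definition followsI (s : strategyI) (x : nat -> moveI) (n : nat -> nat) : Prop :=
  forall i, x i = s (mkseq (fun j => n j.+1) i).

Definition followsII (t : strategyII) (x : nat -> moveI) (n : nat -> nat) : Prop :=
  forall i, n i.+1 = t (mkseq x i.+1).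

Definition winsI (B : set (baire * (nat -> L)))
    (x : nat -> moveI) (n : nat -> nat) : Prop :=
  B (concat (fun i => (x i).2), fun i => (x i).1) /\
  forall i, 1 <= i -> n i < head 0 (val (x i).2).

Definition winningI B (s : strategyI) : Prop :=
  forall x n, followsI s x n -> winsI B x n.

Definition winningII B (t : strategyII) : Prop :=
  forall x n, followsII t x n -> ~ winsI B x n.

End Defs.

Definition is_tree (T : set (seq nat)) : Prop :=
  forall u v, prefix u v -> T v -> T u.

Definition branches (T : set (seq nat)) : set baire :=
  [set f | forall n, T (mkseq f n)].

Definition superperfect_tree (T : set (seq nat)) : Prop :=
  is_tree T /\
  forall u, T u -> exists v,
    [/\ prefix u v, T v & infinite_set [set m : nat | T (rcons v m)]].

Definition superperfect (P : set baire) : Prop :=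
  exists T, superperfect_tree T /\ P = branches T.

Lemma concatE (u : nat -> block) k :
  let w := flatten (mkseq (fun i => val (u i)) k) in
  mkseq (concat u) (size w) = w.
Proof.
pose W k := flatten (mkseq (fun i => val (u i)) k).
have WS j : W j.+1 = W j ++ val (u j).
  by rewrite /W mkseqS -cats1 flatten_cat /= cats0.
have Wle i j : i <= j -> prefix (W i) (W j).
  move=> /subnKC <-; elim: (j - i) => [|p IH]; first by rewrite addn0 prefix_refl.
  by rewrite addnS WS; apply: prefix_trans IH (prefix_prefix _ _).
have Wsz j : j <= size (W j).
  elim: j => // j IH; rewrite WS size_cat -addn1 leq_add // lt0n size_eq0.
  exact: (valP (u j)).
have Wnth i j m : m < size (W i) -> i <= j -> nth 0 (W j) m = nth 0 (W i) m.
  by move=> mi /Wle /prefixP [s ->]; rewrite nth_cat mi.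
apply: (@eq_from_nth _ 0) => [|m]; rewrite size_mkseq // => mk.
rewrite nth_mkseq // -[LHS]/(nth 0 (W m.+1) m) -[RHS]/(nth 0 (W k) m).
have [le|/ltnW le] := leqP m.+1 k; first by rewrite (Wnth m.+1 k).
by rewrite (Wnth k m.+1).
Qed.

(* Main.v *)
Require Import Defs.
From mathcomp Require Import all_boot all_order.
From mathcomp Require Import boolp classical_sets cardinality.
From mathcomp Require wochoice.

Local Open Scope classical_set_scope.
Local Open Scope card_scope.

(** If Player I wins by a strategy [s], consider the tree of all initial segments
    of the sequences that [s] can spell out ([outcome_tree]). Since Player II may
    answer with any number and the next block must begin above it, every
    node can be extended to an infinitely splitting one. A branch [f] of the tree
    comes from a complete run: at any position, only the finitely many
    answers smaller than the next digit of [f] are compatible with [f], so a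
    compactness argument ([branches_outcome_tree]) finds infinitely many answers
    along which [s] spells out [f]. As [s] wins that run, [f] is in the
    projection.

    If Player II wins by a strategy [t], let [f] be in the projection, with
    witness [xi]. Player I could try to play [xi] and to cut [f] into blocks; as
    this cannot succeed, there is a position [p] from which no further block of
    [f] leads to a position where the next digit of [f] beats the answer of [t]
    ([winningII_trapped]). Then, from there on, each digit of [f] is bounded by a
    function of the preceding ones, so that [f] lies in a finitely branching tree
    and is bounded by a function that depends only on [p], on the next ordinal of
    [xi] and on a finite initial segment of [f] ([trapped_bounded]). By Hessenberg's
    theorem [L * L <= L] for the infinite type [L] ([infinite_square]), there are
    at most [L] such parameters ([infinite_moves_inj]). *)

(** * Cardinality: an infinite type absorbs pairs and finite sequences *)

Lemma card_le_rel {T U} (A : set T) (B : set U) (R : T -> U -> Prop) :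
    (forall a, A a -> exists2 b, B b & R a b) ->
    (forall a a' b, R a b -> R a' b -> a = a') ->
  A #<= B.
Proof.
move=> tot inj; have [->|/set0P[a0 /tot[b0 _ _]]] := eqVneq A set0.
  exact: card_ge0.
have /choice[f fP] a : exists b, A a -> B b /\ R a b.
  by have [/tot[b ? ?]|?] := pselect (A a); [exists b | exists b0].
have f_inj : {in A &, injective f}.
  move=> a a' /set_mem /fP[_ Ra] /set_mem /fP[_ Ra'] faa'.
  by apply: inj Ra _; rewrite faa'.
apply: card_le_trans (subset_card_le (_ : f @` A `<=` B)).
  by have := inj_card_eq f_inj; rewrite card_eq_sym card_eq_le => /andP[].
by move=> _ [a /fP[Ba _] <-].
Qed.

Lemma card_le_inj {T U} (A : set T) (B : set U) : U -> A #<= B ->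
  exists f : T -> U, (forall x, A x -> B (f x)) /\
    (forall x y, A x -> A y -> f x = f y -> x = y).
Proof.
elim/Ppointed: U => U in B *; first by move=> /no.
move=> _ /pcard_leP/injfunPex[f fAB f_inj]; exists f; split=> [|x y Ax Ay].
  exact: fAB.
by apply: f_inj; apply: mem_set.
Qed.

(** A maximal partial bijection between [A] and [B] must exhaust one of the two
    sets: otherwise a new pair of unused points could be added to it. *)
Lemma card_le_total {T U} (A : set T) (B : set U) : A #<= B \/ B #<= A.
Proof.
pose P (R : set (T * U)) := [/\ R `<=` A `*` B,
  forall a a' b, R (a, b) -> R (a', b) -> a = a' &
  forall a b b', R (a, b) -> R (a, b') -> b = b'].
have [R [[RAB Rinjl Rinjr] Rmax]] : exists R,
    P R /\ forall R', R `<` R' -> ~ P R'.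
  apply: Zorn_bigcup => F FP Ftot; split.
  - by move=> z [R FR Rz]; have [+ _ _] := FP _ FR; apply.
  - move=> a a' b [R FR Rab] [R' FR' Rab'].
    have [RR'|R'R] := Ftot _ _ FR FR'.
      by have [_ + _] := FP _ FR'; apply; [apply: RR' Rab | ].
    by have [_ + _] := FP _ FR; apply; [exact: Rab | apply: R'R].
  - move=> a b b' [R FR Rab] [R' FR' Rab'].
    have [RR'|R'R] := Ftot _ _ FR FR'.
      by have [_ _ +] := FP _ FR'; apply; [apply: RR' Rab | ].
    by have [_ _ +] := FP _ FR; apply; [exact: Rab | apply: R'R].
have [Atot|/existsNP[a0 /not_implyP[Aa0 noa0]]] :=
    pselect (forall a, A a -> exists b, R (a, b)).
  left; apply: (card_le_rel _ _ (fun a b => R (a, b))) => // a /Atot[b Rab].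
  by exists b => //; have [] := RAB _ Rab.
right; apply: (card_le_rel _ _ (fun b a => R (a, b))) => [b Bb|b b' a].
  2: exact: Rinjr.
apply: contrapT => nob.
have {}nob a : ~ R (a, b).
  by move=> Rab; apply: nob; exists a; have [] := RAB _ Rab.
have {}noa0 b' : ~ R (a0, b') by move=> Rab; apply: noa0; exists b'.
apply: (Rmax (R `|` [set (a0, b)])).
  split; first exact: subsetUl.
  by move=> /(_ (a0, b)); move/(_ (or_intror erefl)); apply: nob.
split=> [_ [/RAB //|-> //]|a a' b'|a b' b''].
- move=> [Rab|[ea eb]] [Rab'|[ea' eb']].
  + exact: Rinjl Rab Rab'.
  + by case: (nob a); rewrite -eb'.
  + by case: (nob a'); rewrite -eb.
  + by rewrite ea ea'.
- move=> [Rab|[ea eb]] [Rab'|[ea' eb']].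
  + exact: Rinjr Rab Rab'.
  + by case: (noa0 b'); rewrite -ea'.
  + by case: (noa0 b''); rewrite -ea.
  + by rewrite eb eb'.
Qed.

(** The set [X] such that [G] is defined on [X * X]. *)
Definition diag_dom {T} (G : set (T * T * T)) : set T :=
  [set a | exists c, G (a, a, c)].

(** [G] is the graph of a possibly multivalued embedding of [X * X] into [X], where
    the set [X] is read off from the diagonal. Encoding the embedding as a set of
    triples makes the union of a chain an embedding again, as Zorn's lemma
    requires. *)
Definition square_embedding {T} (G : set (T * T * T)) : Prop :=
  [/\ forall a b c, G (a, b, c) -> [/\ diag_dom G a, diag_dom G b & diag_dom G c],
      forall a b, diag_dom G a -> diag_dom G b -> exists c, G (a, b, c) &
      forall p q c, G (p, c) -> G (q, c) -> p = q].

Lemma square_embedding_bigcup {T} (F : set (set (T * T * T))) :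
  F `<=` square_embedding -> total_on F subset ->
  square_embedding (\bigcup_(G in F) G).
Proof.
move=> Fsq Ftot.
have common G G' : F G -> F G' -> exists H, [/\ F H, G `<=` H & G' `<=` H].
  move=> FG FG'; have [?|?] := Ftot _ _ FG FG'.
    by exists G'; split.
  by exists G; split.
have dom_sub G : F G -> diag_dom G `<=` diag_dom (\bigcup_(G in F) G).
  by move=> FG a [c Gc]; exists c, G.
split=> [a b c [G FG Gabc]|a b [ca [G FG Ga]] [cb [G' FG' G'b]]|p q c].
- by have [+ _ _] := Fsq _ FG => /(_ _ _ _ Gabc)[]; split; apply: (dom_sub _ FG).
- have [H [FH GH G'H]] := common _ _ FG FG'; have [_ Htot _] := Fsq _ FH.
  have [||d Hd] := Htot a b; [by exists ca; apply: GH|by exists cb; apply: G'H|].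
  by exists d, H.
- move=> [G FG Gp] [G' FG' G'q]; have [H [FH GH G'H]] := common _ _ FG FG'.
  by have [_ _ +] := Fsq _ FH; apply; [apply: GH Gp | apply: G'H].
Qed.

Lemma square_embedding_fun {T} (G : set (T * T * T)) : square_embedding G ->
  let D := diag_dom G in
  exists f : T * T -> T,
    [/\ forall a b, D a -> D b -> G (a, b, f (a, b)),
        forall a b, D a -> D b -> D (f (a, b)) &
        forall a b a' b', D a -> D b -> D a' -> D b' ->
          f (a, b) = f (a', b') -> a = a' /\ b = b'].
Proof.
move=> [Gdom Gtot Ginj] D.
have /choice[f fP] (p : T * T) : exists d, D p.1 -> D p.2 -> G (p, d).
  case: p => a b; have [Da|?] := pselect (D a); last by exists a.
  by have [/(Gtot _ _ Da)[d ?]|?] := pselect (D b); [exists d | exists a].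
exists f; split=> [a b|a b Da Db|a b a' b' Da Db Da' Db' E].
  exact: (fP (a, b)).
  by have [] := Gdom _ _ _ (fP (a, b) Da Db).
suff [-> ->] : (a, b) = (a', b') by [].
by apply: Ginj (fP (a, b) Da Db) _; rewrite E; exact: (fP (a', b')).
Qed.

(** If the complement of [X] contains a copy [h X] of [X], then the three missing
    squares of [(X + h X) * (X + h X)] can be sent injectively into [h X]: code
    [(a, b)] in [X] by the given embedding [f], add a tag for the square, again
    by [f], and apply [h]. The sequence [c] provides the tags. *)
Lemma square_embedding_extend {T} (c : nat -> T) (G : set (T * T * T)) :
    injective c -> (forall i, diag_dom G (c i)) -> square_embedding G ->
    diag_dom G #<= ~` diag_dom G ->
  exists2 G', G `<` G' & square_embedding G'.
Proof.
set D := diag_dom G => c_inj Dc Gsq /(card_le_inj _ _ (c 0))[h [hD h_inj]].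
have [Gdom _ Ginj] := Gsq.
have [f [fP fD f_inj]] := square_embedding_fun _ Gsq.
(* [e false] and [e true] parametrize the old points and their copies. *)
pose e (i : bool) a := if i then h a else a.
pose v i j a b := h (f (c (pickle (i : bool, j : bool)), f (a, b))).
pose K := [set z : T * T * T | exists i j a b,
  [/\ D a, D b, i || j & z = (e i a, e j b, v i j a b)]].
have Dcf k a b : D a -> D b -> D (f (c k, f (a, b))).
  by move=> Da Db; apply: fD (Dc k) (fD _ _ Da Db).
have vND i j a b : D a -> D b -> ~ D (v i j a b).
  by move=> Da Db; apply: hD; apply: Dcf.
have v_inj i j a b i' j' a' b' : D a -> D b -> D a' -> D b' ->
    v i j a b = v i' j' a' b' -> [/\ i = i', j = j', a = a' & b = b'].
  move=> Da Db Da' Db' /(h_inj _ _ (Dcf _ _ _ Da Db) (Dcf _ _ _ Da' Db')) E.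
  have [ck fab] := f_inj _ _ _ _ (Dc _) (fD _ _ Da Db) (Dc _) (fD _ _ Da' Db') E.
  have [-> ->] := f_inj _ _ _ _ Da Db Da' Db' fab.
  by have /(pcan_inj pickleK)[-> ->] := c_inj _ _ ck.
have domP x : diag_dom (G `|` K) x <-> exists i a, D a /\ x = e i a.
  split=> [[d [Gx|[i [j [a [b [Da _ _ [-> _ _]]]]]]]]|[i [a [Da ->]]]].
  - by exists false, x; split=> //; exists d.
  - by exists i, a.
  - case: i => /=; last by have [d ?] := Da; exists d; left.
    by exists (v true true a a); right; exists true, true, a, a.
exists (G `|` K).
  split; first exact: subsetUl.
  have KX : K (h (c 0), h (c 0), v true true (c 0) (c 0)).
    by exists true, true, (c 0), (c 0).
  move=> /(_ _ (or_intror KX)) /Gdom[/(hD (c 0)) []]; exact: Dc.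
split=> [a b d|x y /domP[i [a [Da ->]]] /domP[j [b [Db ->]]]|p q d].
- case=> [/Gdom[Da Db Dd]|[i [j [a' [b' [Da' Db' _ [-> -> ->]]]]]]].
    by split; apply/domP; [exists false, a | exists false, b | exists false, d].
  split; apply/domP; [by exists i, a'|by exists j, b'|].
  exists true, (f (c (pickle (i, j)), f (a', b'))); split=> //.
  exact: Dcf.
- case ij : (i || j).
    by exists (v i j a b); right; exists i, j, a, b.
  move: ij; case: i j => [] [] //= _.
  by exists (f (a, b)); left; apply: fP.
- move=> [Gp|[i [j [a [b [Da Db _ [-> ->]]]]]]]
    [Gq|[i' [j' [a' [b' [Da' Db' _ [-> E]]]]]]].
  + exact: Ginj Gp Gq.
  + by case: p Gp => p1 p2 /Gdom[_ _]; rewrite E => /(vND _ _ _ _ Da' Db').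
  + by case: q Gq => q1 q2 /Gdom[_ _ /(vND _ _ _ _ Da Db)].
  + by have [-> -> -> ->] := v_inj _ _ _ _ _ _ _ _ Da Db Da' Db' E.
Qed.

(** Hessenberg's theorem. Start from a countable subset, where pairing is
    explicit, and let [X] be the domain of a maximal embedding [X * X -> X]. By
    comparability and [square_embedding_extend], the complement of [X] injects
    into [X], so that the whole type injects into two copies of [X], hence into
    [X]. *)
Lemma infinite_square {T} : infinite_set [set: T] ->
  exists f : T * T -> T, injective f.
Proof.
move=> /infiniteP infT.
have [t0 _] : [set: T] !=set0.
  by apply: infinite_setN0; apply/infiniteP.
have [c [_ c_injT]] := card_le_inj _ _ t0 infT.
have {c_injT} c_inj : injective c by move=> i j; apply: c_injT.
pose G0 : set (T * T * T) :=
  [set z | exists i j, z = (c i, c j, c (pickle (i, j)))].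
have G0c i : diag_dom G0 (c i) by eexists; exists i, i.
have G0sq : square_embedding G0.
  split=> [a b d [i [j [-> -> ->]]] //||p q d].
    move=> a b [? [i [_ [-> _ _]]]] [? [j [_ [-> _ _]]]].
    by eexists; exists i, j.
  by move=> [i [j [-> ->]]] [i' [j' [-> /c_inj /(pcan_inj pickleK)[-> ->]]]].
have [G [Gsq Gmax]] : exists G, square_embedding (G0 `|` G) /\
    forall G', G `<` G' -> ~ square_embedding (G0 `|` G').
  (* [G0] is joined to each element, so that the empty chain is covered. *)
  apply: (@Zorn_bigcup _ [set G | square_embedding (G0 `|` G)]) => F Fsq Ftot /=.
  have [->|/set0P[H0 FH0]] := eqVneq F set0; first by rewrite bigcup_set0 setU0.
  have -> : G0 `|` \bigcup_(G in F) G = \bigcup_(G in [set G0 `|` G | G in F]) G.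
    rewrite bigcup_image; apply/seteqP; split=> z.
      by move=> [?|[G FG ?]]; [exists H0 => //; left | exists G => //; right].
    by move=> [G FG [?|?]]; [left | right; exists G].
  apply: square_embedding_bigcup => [_ [G /Fsq ? <-] //|].
  move=> _ _ [G FG <-] [G' FG' <-].
  by have [?|?] := Ftot _ _ FG FG'; [left | right]; apply: setUS.
set H := G0 `|` G in Gsq; set D := diag_dom H.
have Dc i : D (c i) by have [d ?] := G0c i; exists d; left.
have [/(square_embedding_extend c H c_inj Dc Gsq)[G' [HG' nG'H] G'sq]|] :=
    card_le_total D (~` D).
  case: (Gmax G'); last first.
    by rewrite setUidr // => z G0z; apply: HG'; left.
  split; first by move=> z Gz; apply: HG'; right.
  by move=> G'G; apply: nG'H => z /G'G; right.
move=> /(card_le_inj _ _ t0)[g [gD g_inj]].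
have [f [_ fD f_inj]] := square_embedding_fun _ Gsq.
(* [e] injects [T] into [D]: the tags [c 0] and [c 1] separate the two halves. *)
pose e x := if pselect (D x) then f (c 0, x) else f (c 1, g x).
have eD x : D (e x).
  rewrite /e; case: pselect => Dx; first exact: fD (Dc 0) Dx.
  exact: fD (Dc 1) (gD _ Dx).
have e_inj : injective e.
  move=> x y; rewrite /e; case: pselect => Dx; case: pselect => Dy E.
  - by have [] := f_inj _ _ _ _ (Dc 0) Dx (Dc 0) Dy E.
  - by have [/c_inj] := f_inj _ _ _ _ (Dc 0) Dx (Dc 1) (gD _ Dy) E.
  - by have [/c_inj] := f_inj _ _ _ _ (Dc 1) (gD _ Dx) (Dc 0) Dy E.
  - have [_ gxy] := f_inj _ _ _ _ (Dc 1) (gD _ Dx) (Dc 1) (gD _ Dy) E.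
    exact: g_inj gxy.
exists (fun p => f (e p.1, e p.2)) => -[x y] [x' y'] /= E.
by have [/e_inj -> /e_inj ->] := f_inj _ _ _ _ (eD _) (eD _) (eD _) (eD _) E.
Qed.

(** A sequence is coded by its length together with its iterated pairing; once the
    length is known, the iterated pairing determines the entries. *)
Lemma infinite_seq_inj {T U} (g : U -> T) :
    infinite_set [set: T] -> injective g ->
  exists f : seq U -> T, injective f.
Proof.
move=> infT g_inj; have [f f_inj] := infinite_square infT.
have /infiniteP infT' := infT; have [t0 _] := infinite_setN0 infT.
have [c [_ c_inj]] := card_le_inj _ _ t0 infT'.
pose fold s := foldr (fun x y => f (g x, y)) t0 s.
exists (fun s => f (c (size s), fold s)) => s s' /f_inj[/c_inj sz].
elim: s s' {sz}(sz I I) => [|x s IH] [|x' s'] //= [sz] /f_inj[/g_inj-> E].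
by rewrite (IH s').
Qed.

Lemma infinite_prod_inj {T U V} (g : U -> T) (h : V -> T) :
    infinite_set [set: T] -> injective g -> injective h ->
  exists f : U * V -> T, injective f.
Proof.
move=> /infinite_square[f f_inj] g_inj h_inj.
by exists (fun p => f (g p.1, h p.2)) => -[x y] [x' y'] /f_inj[/g_inj-> /h_inj->].
Qed.

Lemma infinite_count_inj {T} (U : countType) : infinite_set [set: T] ->
  exists f : U -> T, injective f.
Proof.
move=> infT; have [t0 _] := infinite_setN0 infT.
have /infiniteP/(card_le_inj _ _ t0)[c [_ c_inj]] := infT.
by exists (c \o pickle) => x y /= /c_inj E; apply: (pcan_inj pickleK); apply: E.
Qed.

(** The type of the parameters of [trapped] below. *)
Lemma infinite_moves_inj {L} : infinite_set [set: L] ->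
  exists f : seq (moveI L) * (L * seq nat) -> L, injective f.
Proof.
move=> infL.
have [b b_inj] := infinite_count_inj block infL.
have [w w_inj] := infinite_count_inj (seq nat) infL.
have [m m_inj] := infinite_prod_inj id b infL (fun _ _ => id) b_inj.
have [p p_inj] := infinite_seq_inj m infL m_inj.
have [q q_inj] := infinite_prod_inj id w infL (fun _ _ => id) w_inj.
exact: infinite_prod_inj p q infL p_inj q_inj.
Qed.

(** * Runs and their concatenation *)

(** Builds an infinite run from a property of its finite positions. *)
Lemma dependent_choice_seq {T : Type} (S : set (seq T)) :
    S [::] -> (forall p, S p -> exists x, S (rcons p x)) ->
  exists x : nat -> T, forall k, S (mkseq x k).
Proof.
move=> S0 Sstep; have [x0 _] := Sstep _ S0.
have /choice[g gP] p : exists x, S p -> S (rcons p x).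
  by have [/Sstep[x]|nSp] := pselect (S p); [exists x | exists x0].
pose run k := iter k (fun p => rcons p (g p)) [::].
exists (fun k => g (run k)) => k.
suff <- : run k = mkseq (fun k => g (run k)) k.
  by elim: k => [|k IH] //=; apply: gP.
by elim: k => [|k IH] //; rewrite mkseqS -IH.
Qed.

Lemma leq_size_blocks (u : nat -> block) k :
  k <= size (flatten (mkseq (fun i => val (u i)) k)).
Proof.
elim: k => // k IH; rewrite mkseqS flatten_rcons size_cat -addn1 leq_add //.
rewrite lt0n size_eq0; exact: (valP (u k)).
Qed.

Lemma concat_eq (u : nat -> block) (f : baire) :
    (forall k, let w := flatten (mkseq (fun i => val (u i)) k) in
       mkseq f (size w) = w) ->
  concat u = f.
Proof.
move=> fw; apply/funext => k; rewrite /concat.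
set w := flatten _; have kw : k < size w by apply: leq_size_blocks.
by rewrite -[w](fw k.+1) nth_mkseq.
Qed.

Lemma take_mkseq {T} (f : nat -> T) i k :
  i <= k -> take i (mkseq f k) = mkseq f i.
Proof. by move=> ik; rewrite /mkseq -map_take take_iota (minn_idPl ik). Qed.

Lemma unbounded_infinite (A : set nat) :
  (forall n, exists2 m, n < m & A m) -> infinite_set A.
Proof.
move=> unb /finite_seqP[s As]; have [m] := unb (\max_(i <- s) i).
by rewrite As /= => + ms; rewrite ltnNge (leq_bigmax_seq (F := id)).
Qed.

(** * A winning strategy of Player I *)

(** The finite sequence spelled out by the blocks that [s] plays, up to and
    including the reaction to the last of Player II's answers [ns]. *)
Definition outcome {L} (s : strategyI L) (ns : seq nat) : seq nat :=
  flatten (mkseq (fun i => val (s (take i ns)).2) (size ns).+1).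

Lemma outcome_rcons {L} (s : strategyI L) ns a :
  outcome s (rcons ns a) = outcome s ns ++ val (s (rcons ns a)).2.
Proof.
rewrite /outcome size_rcons mkseqS flatten_rcons.
rewrite [take _.+1 _]take_oversize ?size_rcons //; congr (_ ++ _); congr flatten.
apply/eq_in_map => i; rewrite mem_iota => /andP[_ ik].
by rewrite -cats1 takel_cat.
Qed.

Lemma outcome_mkseq {L} (s : strategyI L) (a : nat -> nat) k :
  outcome s (mkseq a k) = flatten (mkseq (fun i => val (s (mkseq a i)).2) k.+1).
Proof.
rewrite /outcome size_mkseq; congr flatten; apply/eq_in_map => i.
by rewrite mem_iota => /andP[_ ik]; rewrite take_mkseq -1?ltnS.
Qed.

Lemma prefix_outcome {L} (s : strategyI L) ns ms :
  prefix (outcome s ns) (outcome s (ns ++ ms)).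
Proof.
elim/last_ind: ms => [|ms a IH]; first by rewrite cats0 prefix_refl.
by rewrite -rcons_cat outcome_rcons prefix_catl.
Qed.

Lemma winningI_run {L} (B : set (baire * (nat -> L))) (s : strategyI L) a :
    winningI B s ->
  proj B (concat (fun i => (s (mkseq a i)).2)) /\
  forall i, a i < head 0 (val (s (mkseq a i.+1)).2).
Proof.
move=> /(_ (fun i => s (mkseq a i)) (fun j => a j.-1)) [//|BI lt_a].
by split=> [|i]; [exists (fun i => (s (mkseq a i)).1) | apply: (lt_a i.+1)].
Qed.

(** A finite sequence of answers extends to a complete run, which [s] wins; so the
    rules already hold along the finite sequence. *)
Lemma winningI_head {L} (B : set (baire * (nat -> L))) (s : strategyI L) ns a :
  winningI B s -> a < head 0 (val (s (rcons ns a)).2).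
Proof.
move=> /(@winningI_run _ _ _ (nth 0 (rcons ns a))) [_ /(_ (size ns))].
by rewrite -(size_rcons ns a) mkseq_nth nth_rcons ltnn eqxx.
Qed.

Definition outcome_tree {L} (s : strategyI L) : set (seq nat) :=
  [set u | exists ns, prefix u (outcome s ns)].

(** After [outcome s ns], the answer [n] forces the next digit to be greater than
    [n]; letting [n] grow gives infinitely many successors. *)
Lemma outcome_tree_superperfect {L} (B : set (baire * (nat -> L))) s :
  winningI B s -> superperfect_tree (outcome_tree s).
Proof.
move=> win; split=> [u v uv [ns vns]|u [ns uns]].
  by exists ns; apply: prefix_trans vns.
exists (outcome s ns); split=> //; first by exists ns; rewrite prefix_refl.
apply: unbounded_infinite => n; exists (head 0 (val (s (rcons ns n)).2)).
  exact: winningI_head win.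
exists (rcons ns n); rewrite outcome_rcons -cats1.
by case: (s _).2 => -[|m w] //= _; rewrite -(cat1s m w) catA prefix_prefix.
Qed.

(** König's argument. Call a sequence of answers [ns] good if arbitrarily long
    initial segments of [f] are compatible with continuations of [ns]. A good
    [ns] has a good extension by one answer: only answers [a] smaller than the
    next digit of [f] can occur, hence finitely many, and one of them works for
    all lengths. The resulting infinite sequence of answers yields a run won by
    Player I that spells out [f]. *)
Lemma branches_outcome_tree {L} (B : set (baire * (nat -> L))) s :
  winningI B s -> branches (outcome_tree s) `<=` proj B.
Proof.
move=> win f fT.
pose S ns := forall n, exists ms, prefix (mkseq f n) (outcome s (ns ++ ms)).
have Sprefix ns : S ns -> mkseq f (size (outcome s ns)) = outcome s ns.
  move=> /(_ (size (outcome s ns)))[ms]; have := prefix_outcome s ns ms.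
  by rewrite !prefixE size_mkseq => /eqP -> /eqP.
have Sstep ns : S ns -> exists a, S (rcons ns a).
  move=> Sns; apply: contrapT => /forallNP noS.
  have /choice[N NP] a : exists n, forall ms,
      ~ prefix (mkseq f n) (outcome s (rcons ns a ++ ms)).
    by have /existsNP[n /forallNP nP] := noS a; exists n.
  set l := size (outcome s ns).
  (* The summand [l.+1] rules out the empty continuation; the maximum refutes
     every answer below the digit [f l]. *)
  pose M := l.+1 + \max_(a < f l) N a.
  have [ms] := Sns M.
  case: ms => [/size_prefix|a ms].
    by rewrite cats0 size_mkseq -/l /M addSn ltnNge leq_addr.
  rewrite -cat_rcons => fM.
  have lt_af : a < f l.
    suff <- : head 0 (val (s (rcons ns a)).2) = f l by apply: winningI_head win.
    have [r] := prefixP (prefix_outcome s (rcons ns a) ms).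
    move: fM => /prefixP[q ->] /(congr1 (nth 0 ^~ l)).
    rewrite outcome_rcons -catA !nth_cat size_mkseq /M leq_addr ltnn subnn.
    rewrite nth_mkseq ?leq_addr // => ->.
    by case: (s _).2 => -[].
  apply: (NP a ms); apply: prefix_trans fM.
  have le_NM : N a <= M.
    apply: leq_trans (leq_addl _ _).
    exact: (leq_bigmax (F := fun i : 'I_(f l) => N i) (Ordinal lt_af)).
  by rewrite -(take_mkseq f _ _ le_NM) prefix_take.
have [|a aP] := dependent_choice_seq S _ Sstep; first exact: fT.
have [+ _] := winningI_run B s a win.
congr (proj B _); apply: concat_eq => -[|k] w; rewrite /w //.
by rewrite -outcome_mkseq Sprefix.
Qed.

Lemma branches_outcome_tree_nonempty {L} (s : strategyI L) :
  branches (outcome_tree s) !=set0.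
Proof.
pose u i := (s (mkseq (fun=> 0) i)).2; exists (concat u) => n.
exists (mkseq (fun=> 0) n); rewrite outcome_mkseq -(concatE u).
have le_n := ltnW (leq_size_blocks u n.+1).
by rewrite -(take_mkseq (concat u) n _ le_n) prefix_take.
Qed.

(** * A winning strategy of Player II *)

(** The tree of the sequences that obey the bound [h] is finitely branching: each
    level is finite, so the bounds on a level have a maximum. *)
Lemma finitely_branching_bounded (h : seq nat -> nat) :
  exists g : baire, forall f,
    (forall n, f n <= h (mkseq f n)) -> forall n, f n <= g n.
Proof.
pose nodes := fix nodes n : seq (seq nat) := if n isn't n'.+1 then [:: [::]] else
  [seq rcons u a | u <- nodes n', a <- iota 0 (h u).+1].
exists (fun n => \max_(u <- nodes n) h u) => f fh n.
suff fn : mkseq f n \in nodes n.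
  by apply: leq_trans (fh n) _; apply: (leq_bigmax_seq (F := h)).
elim: n => [|n IH] //; rewrite mkseqS; apply/allpairsPdep.
by exists (mkseq f n), (f n); rewrite IH mem_iota ltnS fh.
Qed.

Definition blocks_of {L} (p : seq (moveI L)) : seq nat :=
  flatten [seq val x.2 | x <- p].

Definition block_of (u : seq nat) : block := insubd (exist _ [:: 0] isT) u.

(** At a position [p] of the game, when Player I is about to play the ordinal
    [z], no initial part of the rest of [f] is a good block: the answer of [t] to
    such a block is at least the digit of [f] that follows it. The sequence [v]
    is meant to be [f] up to and including the first digit of the block. *)
Definition trapped {L} (t : strategyII L) (p : seq (moveI L)) (z : L)
    (v : seq nat) (f : baire) : Prop :=
  mkseq f (size v) = v /\
  forall n, size v <= n ->
    f n <= t (rcons p (z, block_of (drop (size (blocks_of p)) (mkseq f n)))).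

(** The digits of [f] in [v] are known, and each later digit is at most an answer of
    [t] that depends only on the digits before it. *)
Lemma trapped_bounded {L} (t : strategyII L) p z v :
  exists g : baire, forall f, trapped t p z v f -> forall n, f n <= g n.
Proof.
have [g gP] := finitely_branching_bounded (fun u =>
  if size u < size v then nth 0 v (size u)
  else t (rcons p (z, block_of (drop (size (blocks_of p)) u)))).
exists g => f [fv ft]; apply: gP => n; rewrite size_mkseq; case: ltnP => [nv|].
  by rewrite -fv nth_mkseq.
exact: ft.
Qed.

(** If [f], with witness [xi], were in no trap, Player I could play [xi] and cut [f]
    into blocks so that each block begins with a digit greater than the answer of
    [t] to the preceding ones, and would win. *)
Lemma winningII_trapped {L} (B : set (baire * (nat -> L))) (t : strategyII L) f :
  winningII B t -> proj B f -> exists p z v, trapped t p z v f.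
Proof.
move=> win [xi Bf]; apply: contrapT => free.
(* The last clause is about the first digit of the block that comes after [p]. *)
pose S (p : seq (moveI L)) :=
  [/\ mkseq f (size (blocks_of p)) = blocks_of p,
      [seq x.1 | x <- p] = mkseq xi (size p) &
      0 < size p -> t p < f (size (blocks_of p))].
have Sstep p : S p -> exists x, S (rcons p x).
  move=> [fp xip _]; set l := size (blocks_of p) in fp.
  pose x n : moveI L := (xi (size p), block_of (drop l (mkseq f n))).
  have [n ln t_lt] : exists2 n, l < n & t (rcons p (x n)) < f n.
    apply: contrapT => no_n; apply: free.
    exists p, (xi (size p)), (mkseq f l.+1); rewrite /trapped size_mkseq.
    split=> // n ln; rewrite leqNgt; apply/negP => t_lt.
    by apply: no_n; exists n.
  exists (x n).
  have blocks_x : blocks_of (rcons p (x n)) = mkseq f n.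
    rewrite /blocks_of map_rcons flatten_rcons -/(blocks_of p) -fp.
    rewrite -(take_mkseq f _ _ (ltnW ln)) /x /= /block_of insubdK.
      exact: cat_take_drop.
    by rewrite unfold_in -size_eq0 size_drop size_mkseq subn_eq0 -ltnNge.
  split; rewrite ?blocks_x ?size_mkseq //.
  by rewrite map_rcons xip size_rcons mkseqS.
have [//|x xP] := dependent_choice_seq S _ Sstep.
have blocksE k :
    blocks_of (mkseq x k) = flatten (mkseq (fun i => val (x i).2) k).
  by rewrite /blocks_of -map_comp.
apply: (win x (fun i => t (mkseq x i))) => //; split=> [|i i0].
  have -> : concat (fun i => (x i).2) = f.
    by apply: concat_eq => k w; rewrite /w -blocksE; have [] := xP k.
  suff -> : (fun i => (x i).1) = xi by [].
  apply/funext => i; have [_ + _] := xP i.+1.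
  rewrite size_mkseq !mkseqS map_rcons => /(congr1 (last (xi 0))).
  by rewrite !last_rcons.
have [_ _] := xP i; rewrite size_mkseq => /(_ i0) /leq_trans; apply.
have [+ _ _] := xP i.+1; rewrite blocksE mkseqS flatten_rcons -blocksE.
move=> /(congr1 (nth 0 ^~ (size (blocks_of (mkseq x i))))) /=.
rewrite nth_mkseq; last first.
  by rewrite size_cat -addn1 leq_add2l lt0n size_eq0; exact: (valP (x i).2).
by rewrite nth_cat ltnn subnn nth0 => ->.
Qed.

(** * The dichotomy *)

(* The infinite ordinal lambda is an infinite well-ordered type L. *)
Theorem theorem4p5p8 (d : Order.disp_t) (L : orderType d)
    (wfL : wochoice.well_order (fun x y : L => (x <= y)%O))
    (infL : infinite_set [set: L])
    (A : set baire) (B : set (baire * (nat -> L)))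
    (AB : A = proj B) :
  ((exists s : strategyI L, winningI B s) ->
     exists P : set baire, [/\ P `<=` A, P !=set0 & superperfect P])
  /\
  ((exists t : strategyII L, winningII B t) -> family_bounded L A).
Proof.
rewrite AB; split=> [[s win]|[t win]].
  exists (branches (outcome_tree s)); split.
  - exact: branches_outcome_tree win.
  - exact: branches_outcome_tree_nonempty.
  - exists (outcome_tree s); split=> //; exact: outcome_tree_superperfect win.
have [q q_inj] := infinite_moves_inj infL.
have /choice[g gP] (k : seq (moveI L) * (L * seq nat)) : exists g : baire,
    forall f, trapped t k.1 k.2.1 k.2.2 f -> forall n, f n <= g n.
  exact: trapped_bounded.
(* [F] enumerates the bounds [g k] by the codes [q k]. *)
have /choice[F FP] (i : L) : exists b : baire, forall k, q k = i -> b = g k.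
  have [[k qk]|nq] := pselect (exists k, q k = i).
    by exists (g k) => k'; rewrite -qk => /q_inj ->.
  by exists (fun=> 0) => k qk; case: nq; exists k.
exists F => f /(winningII_trapped _ _ _ win)[p [z [v tr]]].
exists (q (p, (z, v))); rewrite (FP _ (p, (z, v))) //.
exact: (gP (p, (z, v)) f tr).
Qed.
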